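(* (i) For any $p\geq2$, the $O(n^{-(p-1)/2})$ rate of convergence in the bounds (A) and (B) described in the context cannot be improved. (ii) For any even $p\geq2$, the $O(n^{-p/2})$ rate of convergence in the bounds (C) and (D) described in the context cannot be improved.
   Context: Notation. $Z\sim N(0,1)$ and $\mathbf Z$ is a standard $d$-dimensional normal vector. $h\in C_b^m(\mathbb{R})$ means that $h^{(m-1)}$ exists and is absolutely continuous, with derivatives up to $m$-th order bounded. For a given non-negative function $P$ on $\mathbb R^d$, $g\in C_P^m(\mathbb{R}^d)$ means that all $m$-th order partial derivatives of $g:\mathbb R^d\to\mathbb R$ exist and $\big|\frac{\partial^k g(\mathbf w)}{\partial w_{i_1}\cdots\partial w_{i_k}}\big|^{m/k}\le P(\mathbf w)$ for all $\mathbf w\in\mathbb R^d$ and $k=1,\ldots,m$. A function $g$ is even if $g(-\mathbf w)=g(\mathbf w)$ for all $\mathbf w$. Multivariate setting: $P(\mathbf w)=A+B\sum_{i=1}^d|w_i|^{r_i}$ with $A,B,r_1,\ldots,r_d\ge0$; the $X_{ij}$, $1\le i\le n_j$, $1\le j\le d$, are independent random variables with $\mathbb EX_{ij}^k=\mathbb EZ^k$ for all $i,j$ and all positive integers $k\le p$; $\mathbf W=(W_1,\ldots,W_d)^T$ with $W_j=\frac1{\sqrt{n_j}}\sum_{i=1}^{n_j}X_{ij}$; and $n=\min_{1\le j\le d}n_j$. Univariate setting: $P(w)=A+B|w|^r$ with $A,B,r\ge0$; $X_1,\ldots,X_n$ are independent with $\mathbb EX_i^k=\mathbb EZ^k$ for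 all $i$ and all positive integers $k\le p$; $W=\frac1{\sqrt n}\sum_{i=1}^nX_i$. The bounds whose rates are in question are the following (each is an explicit upper bound involving absolute moments of the summands). (A) Multivariate setting: if $g\in C_P^p(\mathbb R^d)$, $h\in C_b^p(\mathbb R)$ and $\mathbb E|X_{ij}|^{r_l+p+1}<\infty$ for all $i,j,l$, then $|\mathbb Eh(g(\mathbf W))-\mathbb Eh(g(\mathbf Z))|$ is bounded by a quantity of order $n^{-(p-1)/2}$. (B) Univariate setting: if $g\in C_P^{p-1}(\mathbb R)$, $h\in C_b^{p-1}(\mathbb R)$ and $\mathbb E|X_i|^{r+p+2}<\infty$ for all $i$, then $|\mathbb Eh(g(W))-\mathbb Eh(g(Z))|$ is bounded by a quantity of order $n^{-(p-1)/2}$. (C) Multivariate setting, $p$ even: if $g\in C_P^{p+2}(\mathbb R^d)$ is an even function, $h\in C_b^{p+2}(\mathbb R)$ and $\mathbb E|X_{ij}|^{r_l+p+2}<\infty$ for all $i,j,l$, then $|\mathbb Eh(g(\mathbf W))-\mathbb Eh(g(\mathbf Z))|$ is bounded by a quantity of order $n^{-p/2}$. (D) Univariate setting, $p$ even: if $g\in C_P^{p}(\mathbb R)$ is an even function, $h\in C_b^{p}(\mathbb R)$ and $\mathbb E|X_i|^{r+p+4}<\infty$ for all $i$, then $|\mathbb Eh(g(W))-\mathbb Eh(g(Z))|$ is bounded by a quantity of order $n^{-p/2}$. *)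

(* Defs.v *)
From HB Require Import structures.
From mathcomp Require Import all_boot all_order all_algebra.
From mathcomp Require Import all_classical all_reals all_analysis.

Set Implicit Arguments.
Unset Strict Implicit.
Unset Printing Implicit Defensive.

Import Order.TTheory GRing.Theory Num.Theory.
Import numFieldNormedType.Exports.

Local Open Scope classical_set_scope.
Local Open Scope ring_scope.

(* Absolute continuity on the whole real line. Under the additional bound on
   the derivative in [Cb] below, this is the same as absolute continuity on
   every compact interval: both then amount to being Lipschitz. *)
Definition absolutely_continuous (R : realType) (f : R -> R) : Prop :=
  forall e : R, 0 < e -> exists2 dlt : R, 0 < dlt &
    forall (k : nat) (a b : 'I_k -> R),
      (forall i, a i <= b i) ->
      trivIset [set: 'I_k] (fun i => `]a i, b i[%classic) ->
      \sum_i (b i - a i) < dlt ->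
      \sum_i `|f (b i) - f (a i)| < e.

(* C_b^m(R), for m >= 1: the derivatives of orders 1, ..., m are bounded (h
   itself need not be). The derivative of order m is only known to exist almost
   everywhere, and [derive1n m h x] is a junk value elsewhere, hence
   the derivability guard in the bound. *)
Definition Cb (R : realType) (m : nat) (h : R -> R) : Prop :=
  [/\ forall k x, (k.+1 < m)%N -> derivable (derive1n k h) x 1,
      absolutely_continuous (derive1n m.-1 h)
    & exists M : R, forall k x, (k < m)%N ->
        derivable (derive1n k h) x 1 -> `|derive1n k.+1 h x| <= M].

(* [partial [:: i1; ...; ik] g] is d^k g / (dw_i1 ... dw_ik). *)
Fixpoint partial (R : realType) (d : nat) (s : seq 'I_d) (g : 'rV[R]_d -> R)
    : 'rV[R]_d -> R :=
  if s is i :: s' then fun w => 'D_(delta_mx 0 i) (partial s' g) w else g.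

(* C_P^m(R^d) *)
Definition CP (R : realType) (d m : nat) (P g : 'rV[R]_d -> R) : Prop :=
  (forall (s : seq 'I_d) i w, (size s < m)%N ->
     derivable (partial s g) w (delta_mx 0 i)) /\
  (forall (s : seq 'I_d) w, (0 < size s <= m)%N ->
     `|partial s g w| `^ (m%:R / (size s)%:R) <= P w).

(* C_P^m(R) *)
Definition CP1 (R : realType) (m : nat) (P g : R -> R) : Prop :=
  (forall k x, (k < m)%N -> derivable (derive1n k g) x 1) /\
  (forall k x, (0 < k <= m)%N -> `|derive1n k g x| `^ (m%:R / k%:R) <= P x).

Definition growth (R : realType) (d : nat) (A B : R) (r : 'I_d -> R)
    (w : 'rV[R]_d) : R :=
  A + B * \sum_(j < d) `|w 0 j| `^ r j.

Definition growth1 (R : realType) (A B r w : R) : R := A + B * `|w| `^ r.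

Definition even_fun (R : realType) (V : zmodType) (g : V -> R) : Prop :=
  forall w, g (- w) = g w.

Section random_variables.
Context (R : realType) (dT : measure_display) (T : measurableType dT).
Context (Pr : probability T R).

(* The product rule for the whole finite family; subfamilies are covered by
   taking B i = setT. *)
Definition mutually_independent (I : finType) (X : I -> {RV Pr >-> R}) : Prop :=
  forall B : I -> set R, (forall i, measurable (B i)) ->
    Pr (\bigcap_(i in [set: I]) (X i @^-1` B i)) =
    (\prod_(i : I) Pr (X i @^-1` B i))%E.

Definition has_law (mu : set R -> \bar R) (X : {RV Pr >-> R}) : Prop :=
  forall B : set R, measurable B -> distribution Pr X B = mu B.

Definition matches_normal_moments (p : nat) (X : {RV Pr >-> R}) : Prop :=
  forall k : nat, (0 < k <= p)%N ->
    ('E_Pr[fun t => ((X t : R) ^+ k)%R] =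
     'E_(normal_prob 0%R 1%R)[fun z : R => (z ^+ k)%R])%E.

Definition finite_abs_moment (s : R) (X : {RV Pr >-> R}) : Prop :=
  ('E_Pr[fun t => (`|X t : R| `^ s)%R] < +oo)%E.

Definition standardized_sum (n : nat) (X : 'I_n -> {RV Pr >-> R}) (t : T) : R :=
  (Num.sqrt n%:R)^-1 * \sum_(i < n) (X i t : R).

Definition std_normal_vector (d : nat) (Z : 'I_d -> {RV Pr >-> R}) : Prop :=
  mutually_independent Z /\ (forall j, has_law (normal_prob 0 1) (Z j)).

Definition random_vector (d : nat) (Z : 'I_d -> T -> R) (t : T) : 'rV[R]_d :=
  \row_j Z j t.

End random_variables.

(* The rate [rate] is attained in the multivariate bound in dimension d whose
   hypotheses are: g in C_P^m(R^d) and [G g], h in C_b^m(R), p matching moments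
   and E|X_ij|^(r_l + q) < oo. There are fixed P, g, h and a fixed law mu of
   the summands (so all moments entering the bound stay constant) such that the
   error is at least a constant times the rate for every choice of the sample
   sizes n_1, ..., n_d. Integrability is asserted so that the expectations are
   genuine real numbers. *)
Definition multivariate_rate_attained (R : realType) (d p m q : nat)
    (G : ('rV[R]_d -> R) -> Prop) (rate : nat -> R) : Prop :=
  exists (A B : R) (r : 'I_d -> R) (g : 'rV[R]_d -> R) (h : R -> R),
    [/\ 0 <= A, 0 <= B & forall j, 0 <= r j] /\
    [/\ CP m (growth A B r) g, G g & Cb m h] /\
  exists (dZ : measure_display) (TZ : measurableType dZ)
    (PZ : probability TZ R) (Z : 'I_d -> {RV PZ >-> R}),
    std_normal_vector Z /\
    PZ.-integrable [set: TZ] (fun t => (h (g (random_vector Z t)))%:E) /\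
  exists (mu : probability (measurableTypeR R) R) (c : R), 0 < c /\
  forall (n_ : 'I_d -> nat) (n : nat), (forall j, (0 < n_ j)%N) ->
    (exists j, n = n_ j) -> (forall j, (n <= n_ j)%N) ->
  exists (dT : measure_display) (T : measurableType dT)
    (Pr : probability T R) (X : forall j : 'I_d, 'I_(n_ j) -> {RV Pr >-> R}),
  let W t := random_vector (fun j => standardized_sum (X j)) t in
  [/\ mutually_independent
        (fun s : {j : 'I_d & 'I_(n_ j)} => X (tag s) (tagged s)),
      forall j i, has_law mu (X j i),
      forall j i, matches_normal_moments p (X j i)
    & forall j i l, finite_abs_moment (r l + q%:R) (X j i)] /\
  Pr.-integrable [set: T] (fun t => (h (g (W t)))%:E) /\
  ((c * rate n)%:E <=
    `|'E_Pr[fun t => h (g (W t))] -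
      'E_PZ[fun t => h (g (random_vector Z t))]|)%E.

(* The univariate analogue. *)
Definition univariate_rate_attained (R : realType) (p m q : nat)
    (G : (R -> R) -> Prop) (rate : nat -> R) : Prop :=
  exists (A B r : R) (g h : R -> R),
    [/\ 0 <= A, 0 <= B & 0 <= r] /\
    [/\ CP1 m (growth1 A B r) g, G g & Cb m h] /\
    (normal_prob 0 1).-integrable [set: R] (fun z => (h (g z))%:E) /\
  exists (mu : probability (measurableTypeR R) R) (c : R), 0 < c /\
  forall n : nat, (0 < n)%N ->
  exists (dT : measure_display) (T : measurableType dT)
    (Pr : probability T R) (X : 'I_n -> {RV Pr >-> R}),
  let W := standardized_sum X in
  [/\ mutually_independent X,
      forall i, has_law mu (X i),
      forall i, matches_normal_moments p (X i)
    & forall i, finite_abs_moment (r + q%:R) (X i)] /\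
  Pr.-integrable [set: T] (fun t => (h (g (W t)))%:E) /\
  ((c * rate n)%:E <=
    `|'E_Pr[fun t => h (g (W t))] -
      'E_(normal_prob 0%R 1%R)[fun z : R => h (g z)]|)%E.

(* Main.v *)
Require Import Defs.
From HB Require Import structures.
From mathcomp Require Import all_boot all_order all_algebra.
From mathcomp Require Import all_classical all_reals all_analysis.
From mathcomp Require Import measurable_realfun.
From mathcomp Require Import ring lra zify.
Import Order.TTheory GRing.Theory Num.Theory.
Import numFieldNormedType.Exports.
Local Open Scope classical_set_scope.
Local Open Scope ring_scope.
Set Implicit Arguments.
Unset Strict Implicit.
Unset Printing Implicit Defensive.

(** Take [h] the identity and [g] the sum of the [N]-th powers of the
    coordinates, with [N = p + 1] in (i) and [N = p + 2] in (ii), so that [g] is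
    even when [p] is.  Let the summands have a fixed law whose moments [a] agree
    with the normal moments [m] up to order [N - 1] but not at order [N].  The
    moments of a sum of [n] independent copies are the [n]-fold binomial
    convolution power of [a]; at order [N] it differs from that of [m] by
    [n * (a N - m N)].  Since the normal law is stable, dividing by [sqrt n ^ N]
    gives [E W^N - E Z^N = n^(1 - N/2) (a N - m N)].  These errors have the same
    sign in all coordinates, so they do not cancel in [g].

    The law of the summands is obtained by adding to the normal density a small
    multiple of [sum_j (-1)^j 'C(M, j) 1_[0, j]] with [M = N + 1]: up to the
    factor [1 / (k + 1)], its [k]-th moment is the [M]-th finite difference of
    [j ^ (k + 1)], which vanishes for [k < N] and not for [k = N]. *)

(** * Binomial convolution of moment sequences *)

(** The coefficients of the product of the exponential generating functions of [a] and [b]; for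
    moments, those of a sum of two independent variables. *)
Definition binomial_convolution (R : comNzRingType) (a b : nat -> R) (k : nat) : R :=
  \sum_(i < k.+1) (a (k - i)%N * b i) *+ 'C(k, i).

(** The zeroth power is the unit of the convolution, the moment sequence of the constant 0. *)
Fixpoint convolution_power (R : comNzRingType) (a : nat -> R) (n k : nat) : R :=
  if n is n'.+1 then binomial_convolution (convolution_power a n') a k
  else (k == 0%N)%:R.

(* The recursion satisfied by the moments of the centered normal law of
   variance [s]. *)
Definition gaussian_recursion (R : comNzRingType) (s : R) (a : nat -> R) : Prop :=
  forall k, a k.+1 = s * k%:R * a k.-1.

(** Pascal's rule. Shifting a sequence differentiates its exponential generating function, so this
    is the product rule. *)
Lemma binomial_convolutionS (R : comNzRingType) (a b : nat -> R) k :
  binomial_convolution a b k.+1 =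
    binomial_convolution (fun i => a i.+1) b k +
    binomial_convolution a (fun i => b i.+1) k.
Proof.
rewrite /binomial_convolution big_ord_recl /= bin0 subn0.
under eq_bigr => i _ do rewrite /bump /= add1n subSS binS mulrnDr.
rewrite big_split /= addrA; congr (_ + _).
rewrite big_ord_recr /= bin_small // mulr0n addr0.
rewrite [in RHS]big_ord_recl /= bin0 subn0; congr (_ + _).
by apply: eq_bigr => i _; rewrite /bump /= add1n subnSK.
Qed.

(** The sequence [i%:R * a i.-1] has the generating function of [a] times the variable, a factor
    that can be pulled out of a product. *)
Lemma binomial_convolution_mull (R : comNzRingType) (a b : nat -> R) k :
  binomial_convolution (fun i => i%:R * a i.-1) b k =
    k%:R * binomial_convolution a b k.-1.
Proof.
rewrite /binomial_convolution; case: k => [|k].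
  by rewrite big_ord1 subnn !mul0r mul0rn.
rewrite big_ord_recr /= subnn !mul0r mul0rn addr0 mulr_sumr.
apply: eq_bigr => i _; have ik : (i <= k)%N by rewrite -ltnS.
have E : ('C(k.+1, i))%:R * (k.+1 - i)%:R = k.+1%:R * ('C(k, i))%:R :> R.
  by rewrite -!natrM mulnC mul_bin_down.
rewrite -[LHS]mulr_natl /= 2!mulrA E subSn //=.
by rewrite -(mulr_natl (a (k - i)%N * b i)) !mulrA.
Qed.

Lemma binomial_convolutionC (R : comNzRingType) (a b : nat -> R) k :
  binomial_convolution a b k = binomial_convolution b a k.
Proof.
rewrite /binomial_convolution (reindex_inj rev_ord_inj) /=.
apply: eq_bigr => i _; have ik : (i <= k)%N by rewrite -ltnS.
by rewrite subSS subKn // bin_sub // mulrC.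
Qed.

Lemma binomial_convolution_mulr (R : comNzRingType) (a b : nat -> R) k :
  binomial_convolution a (fun i => i%:R * b i.-1) k =
    k%:R * binomial_convolution a b k.-1.
Proof.
by rewrite binomial_convolutionC binomial_convolution_mull binomial_convolutionC.
Qed.

(** For the generating function A of [a] the recursion reads A' = s x A. If also B' = t x B, the
    product rule gives (AB)' = (s + t) x AB. *)
Lemma gaussian_recursion_convolution (R : comNzRingType) (s t : R) (a b : nat -> R) :
  gaussian_recursion s a -> gaussian_recursion t b ->
  gaussian_recursion (s + t) (binomial_convolution a b).
Proof.
move=> ha hb k; rewrite binomial_convolutionS !mulrDl; congr (_ + _).
- rewrite -mulrA -binomial_convolution_mull /binomial_convolution mulr_sumr.
  by apply: eq_bigr => i _; rewrite ha [RHS]mulrnAr; congr (_ *+ _); ring.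
- rewrite -mulrA -binomial_convolution_mulr /binomial_convolution mulr_sumr.
  by apply: eq_bigr => i _; rewrite hb [RHS]mulrnAr; congr (_ *+ _); ring.
Qed.

Lemma gaussian_recursion_power (R : comNzRingType) (a : nat -> R) n :
  gaussian_recursion 1 a -> gaussian_recursion n%:R (convolution_power a n).
Proof.
move=> ha; elim: n => [|n IH]; first by move=> k /=; rewrite !mul0r.
by rewrite -natr1; exact: gaussian_recursion_convolution.
Qed.

Lemma convolution_power0 (R : comNzRingType) (a : nat -> R) n :
  a 0%N = 1 -> convolution_power a n 0 = 1.
Proof.
move=> a0; elim: n => [|n IH] //=.
by rewrite /binomial_convolution big_ord1 IH a0 mul1r.
Qed.

(** Stability of the normal law at the level of moments: both sides satisfy the recursion with
    parameter [n%:R], which determines a sequence from its term of order 0, as the term of order 1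
    is 0. *)
Lemma gaussian_convolution_power (R : realType) (a : nat -> R) n k :
  a 0%N = 1 -> gaussian_recursion 1 a ->
  convolution_power a n k = Num.sqrt n%:R ^+ k * a k.
Proof.
move=> a0 ha; elim/ltn_ind: k => -[|[|k]] IH.
- by rewrite convolution_power0 // a0 mul1r.
- by rewrite gaussian_recursion_power // ha !mulr0 !mul0r mulr0.
- rewrite gaussian_recursion_power // ha /= IH //.
  rewrite 2!exprS mulrA -expr2 sqr_sqrtr ?ler0n //.
  by move: (Num.sqrt _ ^+ k) => x; ring.
Qed.

Lemma convolution_power_eq (R : comNzRingType) (a b : nat -> R) n q :
  (forall k, (k <= q)%N -> a k = b k) ->
  forall k, (k <= q)%N -> convolution_power a n k = convolution_power b n k.
Proof.
move=> ab; elim: n => [|n IH] //= k kq.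
apply: eq_bigr => i _; rewrite IH ?ab // ?(leq_trans (leq_subr _ _)) //.
by rewrite (leq_trans _ kq) // -ltnS.
Qed.

(** At order [q.+1] only the two end terms of the binomial sum involve entries of order [q.+1]; all
    the others agree for [a] and [b]. Each factor thus contributes [a q.+1 - b q.+1] once. *)
Lemma convolution_power_diff (R : comNzRingType) (a b : nat -> R) n q :
  a 0%N = 1 -> (forall k, (k <= q)%N -> a k = b k) ->
  convolution_power a n q.+1 - convolution_power b n q.+1 =
    n%:R * (a q.+1 - b q.+1).
Proof.
move=> a0 ab; have b0 : b 0%N = 1 by rewrite -ab.
have E (c d : nat -> R) : c 0%N = 1 -> d 0%N = 1 ->
    binomial_convolution c d q.+1 = c q.+1 +
      \sum_(i < q) (c (q - i)%N * d i.+1) *+ 'C(q.+1, i.+1) + d q.+1.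
  move=> c0 d0; rewrite /binomial_convolution big_ord_recr /= subnn binn c0.
  by rewrite big_ord_recl /= bin0 subn0 d0 !mulr1n mulr1 mul1r.
elim: n => [|n IH] /=; first by rewrite subrr mul0r.
rewrite !E ?convolution_power0 //.
rewrite (eq_bigr (fun i : 'I_q => (convolution_power b n (q - i)%N * b i.+1) *+
  'C(q.+1, i.+1))); last first.
  by move=> i _; rewrite (convolution_power_eq n ab) ?leq_subr // ab.
rewrite -natr1 mulrDl mul1r -IH; ring.
Qed.

Lemma alternating_binomial_sum (R : comNzRingType) M k : (k <= M)%N ->
  \sum_(j < M.+1) (-1) ^+ j * ('C(M, j))%:R * j%:R ^+ k =
  (k == M)%:R * (-1) ^+ M * M`!%:R :> R.
Proof.
elim: M k => [|M IH] k; first by case: k => // _; rewrite big_ord1 !expr0 !mulr1.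
case: k => [_|k kM].
  transitivity ((1 - 1 : R) ^+ M.+1); last by rewrite subrr expr0n !mul0r.
  rewrite exprBn; apply: eq_bigr => i _.
  by rewrite expr0 !expr1n !mulr1 mulr_natr.
rewrite big_ord_recl expr0n mulr0 add0r.
have T (i : 'I_M.+1) : (-1) ^+ lift ord0 i * ('C(M.+1, lift ord0 i))%:R *
    (lift ord0 i)%:R ^+ k.+1 = - M.+1%:R * \sum_(l < k.+1)
      (-1) ^+ i * ('C(M, i))%:R * (i%:R ^+ (k - l) * 1 ^+ l *+ 'C(k, l)) :> R.
  have E : ('C(M.+1, i.+1))%:R * i.+1%:R = M.+1%:R * ('C(M, i))%:R :> R.
    by rewrite -!natrM mulnC mul_bin_diag.
  rewrite lift0 -mulr_sumr -exprDn natr1 ![_ ^+ _.+1]exprS.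
  rewrite [_ * _%:R ^+ k]mulrC !mulrA -[X in X * _]mulrA.
  rewrite [_ * _%:R ^+ k]mulrC -!mulrA E; ring.
rewrite (eq_bigr _ (fun i _ => T i)).
rewrite -mulr_sumr exchange_big /=.
rewrite (eq_bigr (fun l : 'I_k.+1 => ('C(k, l))%:R *
   (((k - l)%N == M)%:R * (-1) ^+ M * M`!%:R))); last first.
  move=> l _; rewrite -IH ?(leq_trans (leq_subr _ _)) // mulr_sumr.
  by apply: eq_bigr => i _; rewrite expr1n mulr1 -mulr_natr; ring.
(* Only the exponent [k - l = M] can survive, which forces [l = 0] since [k <= M]. *)
rewrite big_ord_recl big1 /=; last first.
  move=> l _; rewrite (_ : _ == _ = false) ?mul0r ?mulr0 //.
  apply/negbTE/eqP; move: (ltn_ord l); rewrite /bump; lia.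
rewrite subn0 bin0 addr0 mul1r eqSS factS natrM exprS; ring.
Qed.

(** * Moments of sums of independent variables *)

(** Integrability is part of the notion so that linearity and Fubini's theorem apply to the
    powers. *)
Definition has_moments (R : realType) (d : measure_display) (T : measurableType d)
    (Pr : {measure set T -> \bar R}) (X : T -> R) (a : nat -> R) : Prop :=
  forall k, Pr.-integrable [set: T] (fun t => (X t ^+ k)%:E) /\
    (\int[Pr]_t (X t ^+ k)%:E = (a k)%:E)%E.

Lemma has_law_integral (R : realType) (d : measure_display) (T : measurableType d)
    (Pr : probability T R) (mu : probability (measurableTypeR R) R)
    (X : {RV Pr >-> R}) (f : R -> R) :
  has_law mu X -> measurable_fun [set: R] f ->
  mu.-integrable [set: R] (EFin \o f) ->
  Pr.-integrable [set: T] (EFin \o (f \o X)) /\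
  (\int[Pr]_t (f (X t))%:E = \int[mu]_x (f x)%:E)%E.
Proof.
move=> lawX mf intf.
(* [R] and [measurableTypeR R] carry the same sigma-algebra under two different
   displays. *)
pose Y : T -> measurableTypeR R := X.
have mX : measurable_fun [set: T] X by exact: measurable_funP.
have mY : measurable_fun [set: T] Y by exact: mX.
pose Z : {mfun T >-> measurableTypeR R} :=
  HB.pack Y (isMeasurableFun.Build _ _ _ _ Y mY).
have mEf : measurable_fun [set: measurableTypeR R] (EFin \o f).
  exact/measurable_EFinP.
have E (g : measurableTypeR R -> \bar R) :
    (\int[mu]_x g x = \int[distribution Pr Z]_x g x)%E.
  by apply: eq_measure_integral => A mA _; exact/esym/lawX.
have int : Pr.-integrable [set: T] (EFin \o (f \o X)).
  apply/integrableP; split.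
    by apply/measurable_EFinP; exact: measurableT_comp.
  move/integrableP: intf => [_]; rewrite E.
  by rewrite (ge0_integral_pushforward mY) //; exact: measurableT_comp.
by split=> //; rewrite E (integral_pushforward mY).
Qed.

Lemma has_law_moments (R : realType) (d : measure_display) (T : measurableType d)
    (Pr : probability T R) (mu : probability (measurableTypeR R) R)
    (X : {RV Pr >-> R}) (a : nat -> R) :
  has_law mu X -> has_moments mu id a -> has_moments Pr X a.
Proof.
move=> lawX ha k; have [ik ek] := ha k.
have [] := has_law_integral (f := fun x => x ^+ k) lawX _ ik.
  exact: measurable_funX.
by move=> ? E; split => //; rewrite E.
Qed.

Section product.
Context (R : realType) (d1 d2 : measure_display).
Context (T1 : measurableType d1) (T2 : measurableType d2).
Context (P1 : probability T1 R) (P2 : probability T2 R).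

(** Tonelli's theorem on absolute values gives integrability; by Fubini's theorem the inner integral
    then comes out as a constant. *)
Lemma integral_product (f : T1 -> R) (g : T2 -> R) :
  P1.-integrable [set: T1] (EFin \o f) -> P2.-integrable [set: T2] (EFin \o g) ->
  (P1 \x P2)%E.-integrable [set: T1 * T2] (fun z => (f z.1 * g z.2)%:E) /\
  (\int[P1 \x P2]_z (f z.1 * g z.2)%:E =
    (\int[P1]_x (f x)%:E) * (\int[P2]_y (g y)%:E))%E.
Proof.
move=> intf intg.
have mf : measurable_fun [set: T1] f by
  apply/measurable_EFinP; exact: measurable_int intf.
have mg : measurable_fun [set: T2] g by
  apply/measurable_EFinP; exact: measurable_int intg.
have mfg : measurable_fun [set: T1 * T2] (fun z => (f z.1 * g z.2)%:E).
  by apply/measurable_EFinP; apply: measurable_funM; exact: measurableT_comp.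
have ig_fin : (\int[P2]_y (g y)%:E)%E \is a fin_num by exact: integrable_fin_num.
have ifg : (P1 \x P2)%E.-integrable [set: T1 * T2] (fun z => (f z.1 * g z.2)%:E).
  apply/integrable12ltyP => //=.
  under eq_integral => x _.
    under eq_integral => y _ do rewrite normrM EFinM.
    rewrite ge0_integralZl //; last first.
      by apply/measurable_EFinP; exact: measurableT_comp.
    over.
  rewrite ge0_integralZr //; first last.
  - exact: integral_ge0.
  - by apply/measurable_EFinP; exact: measurableT_comp.
  have /integrableP[_ fy] := intf; have /integrableP[_ gy] := intg.
  apply: lte_mul_pinfty => //; first exact: integral_ge0.
  by rewrite ge0_fin_numE //; exact: integral_ge0.
split => //; rewrite -integral12_prod_meas1 // /fubini_F /=.
under eq_integral => x _.
  under eq_integral => y _ do rewrite EFinM.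
  rewrite integralZl //; over.
rewrite -{1}(fineK ig_fin) integralZr // fineK //.
Qed.

(** Serves for sums in which a newly added variable does not occur. *)
Lemma has_moments_fst (X : T1 -> R) (a : nat -> R) :
  has_moments P1 X a -> has_moments (P1 \x P2)%E (X \o fst) a.
Proof.
move=> hX k; have [iX eX] := hX k.
have i1 : P2.-integrable [set: T2] (EFin \o cst (1 : R)).
  exact: finite_measure_integrable_cst.
have [i e] := integral_product iX i1.
split; first by apply: eq_integrable i => //= z _; rewrite mulr1.
under eq_integral do rewrite -[_ ^+ k]mulr1.
rewrite e eX (_ : (\int[P2]_y _)%E = 1%E) ?mule1 //.
transitivity (\int[P2]_y cst 1%E y)%E => //.
by rewrite integral_cst // mul1e; exact: probability_setT.
Qed.

Lemma has_moments_add (X : T1 -> R) (Y : T2 -> R) (a b : nat -> R) :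
  has_moments P1 X a -> has_moments P2 Y b ->
  has_moments (P1 \x P2)%E (fun z => X z.1 + Y z.2) (binomial_convolution a b).
Proof.
move=> hX hY k.
have F (i : 'I_k.+1) := integral_product (hX (k - i)%N).1 (hY i).1.
have E : (fun z : T1 * T2 => ((X z.1 + Y z.2) ^+ k)%:E) =
    (fun z => \sum_(i < k.+1)
      (('C(k, i))%:R%:E * (X z.1 ^+ (k - i) * Y z.2 ^+ i)%:E))%E.
  apply/funext => z; rewrite exprDn -sumEFin; apply: eq_bigr => i _.
  by rewrite -mulr_natl EFinM.
have I (i : 'I_k.+1) : (P1 \x P2)%E.-integrable [set: T1 * T2]
    (fun z => ('C(k, i))%:R%:E * (X z.1 ^+ (k - i) * Y z.2 ^+ i)%:E)%E.
  by apply: integrableZl => //; exact: (F i).1.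
rewrite E; split; first exact: integrable_sum.
rewrite integral_sum // /binomial_convolution -sumEFin; apply: eq_bigr => i _.
rewrite integralZl //; last exact: (F i).1.
by rewrite (F i).2 (hX _).2 (hY _).2 -!EFinM mulr_natl.
Qed.

End product.

(** Variables are added one at a time, as the second projection of a product with [mu]. The
    induction carries the moments of sums over arbitrary index subsets, since in several dimensions
    each coordinate sums only one block of the family. *)
Lemma iid_ordinal (R : realType) (mu : probability (measurableTypeR R) R)
    (a : nat -> R) n : has_moments mu id a ->
  exists (d : measure_display) (T : measurableType d) (Pr : probability T R)
    (X : 'I_n -> {RV Pr >-> R}),
  [/\ mutually_independent X, forall i, has_law mu (X i) &
    forall b : pred 'I_n, has_moments Pr (fun t => \sum_(i | b i) X i t)
      (convolution_power a #|b|)].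
Proof.
move=> ha; elim: n => [|n [d [T [Pr [X [indX lawX momX]]]]]].
  (* The empty family lives on any probability space; [mu] itself is taken. *)
  pose F (i : 'I_0) : measurableTypeR R -> R := cst 0.
  have mF i : measurable_fun [set: measurableTypeR R] (F i).
    exact: measurable_cst.
  pose X i : {mfun measurableTypeR R >-> R} :=
    HB.pack (F i) (isMeasurableFun.Build _ _ _ _ (F i) (mF i)).
  exists _, (measurableTypeR R), mu, X; split => [B mB|[]//|b k].
    rewrite big_ord0 (_ : \bigcap_(_ in _) _ = setT) ?probability_setT //.
    by rewrite -subTset => x _ [].
  rewrite eq_card0; last by case.
  have -> : (fun t : measurableTypeR R => ((\sum_(i | b i) X i t) ^+ k)%:E) =
      cst ((k == 0%N)%:R)%:E.
    by apply/funext => t; rewrite big_ord0 expr0n.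
  split; first exact: finite_measure_integrable_cst.
  rewrite integral_cst // -[RHS]mule1; congr (_ * _)%E.
  exact: probability_setT.
(* Index [ord0] is the new variable, and the indices [lift ord0 j] are the old ones. *)
pose F i : (T * measurableTypeR R)%type -> R :=
  fun z => if unlift ord0 i is Some j then X j z.1 else z.2.
have F0 : F ord0 = snd by apply/funext => z; rewrite /F unlift_none.
have FS j : F (lift ord0 j) = X j \o fst by apply/funext => z; rewrite /F liftK.
have mF i : measurable_fun [set: T * measurableTypeR R] (F i).
  case: (unliftP ord0 i) => [j|] ->; last by rewrite F0; exact: measurable_snd.
  by rewrite FS; apply: measurableT_comp => //; exact: measurable_funP.
pose Pr' : probability (T * measurableTypeR R)%type R := (Pr \x mu)%E.
pose X' i : {RV Pr' >-> R} :=
  HB.pack (F i) (isMeasurableFun.Build _ _ _ _ (F i) (mF i)).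
have lawX' i : has_law mu (X' i).
  move=> B mB; rewrite /distribution /pushforward /=.
  case: (unliftP ord0 i) => [j|] ->.
  - rewrite FS (_ : _ @^-1` B = (X j @^-1` B) `*` setT); last first.
      by apply/seteqP; split => [z /= ?|z []//]; split.
    rewrite product_measure1E //; last first.
      by rewrite -[X in measurable X]setTI; exact: measurable_funP.
    rewrite -[RHS]mule1; congr (_ * _)%E; first exact: lawX.
    exact: probability_setT.
  - rewrite F0 (_ : _ @^-1` B = setT `*` B); last first.
      by apply/seteqP; split => [z /= ?|z []//]; split.
    rewrite product_measure1E // -[RHS]mul1e; congr (_ * _)%E.
    exact: probability_setT.
exists _, (T * measurableTypeR R)%type, Pr', X'; split => // [B mB|b].
- have mX i : measurable (X i @^-1` B (lift ord0 i)).
    by rewrite -[X in measurable X]setTI; exact: measurable_funP.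
  (* The joint event is a rectangle: the joint event of the old variables times the set for the new
     one. *)
  rewrite (_ : \bigcap_(i in _) _ =
      (\bigcap_(i in [set: 'I_n]) (X i @^-1` B (lift ord0 i))) `*` B ord0); last first.
    apply/seteqP; split => z /=.
      move=> Bz; split.
        by move=> j _; have := Bz (lift ord0 j) I; rewrite /= FS.
      by have := Bz ord0 I; rewrite /= F0.
    move=> [Bz1 Bz2] i _ /=; case: (unliftP ord0 i) => [j|] ->.
      by rewrite FS; exact: Bz1.
    by rewrite F0.
  rewrite [LHS]product_measure1E; last 2 first.
  - by apply: fin_bigcap_measurable => [|i _]; [exact: finite_finset|exact: mX].
  - exact: mB.
  rewrite [RHS]big_ord_recl [LHS]muleC; congr (_ * _)%E.
    exact/esym/lawX'.
  rewrite [LHS](indX (fun i => B (lift ord0 i)) (fun i => mB _)).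
  apply: eq_bigr => i _; transitivity (mu (B (lift ord0 i))).
    exact: lawX.
  exact/esym/lawX'.
- pose b' := [pred j | b (lift ord0 j)].
  have -> : (fun t => \sum_(i | b i) X' i t) =
      (fun z => \sum_(j | b' j) X j z.1 + (if b ord0 then z.2 else 0)).
    apply/funext => z; rewrite big_mkcond big_ord_recl addrC /= F0; congr (_ + _).
    by rewrite [RHS]big_mkcond; apply: eq_bigr => j _; rewrite FS.
  have -> : #|b| = (#|b'| + b ord0)%N.
    rewrite -!sum1_card big_mkcond big_ord_recl [in RHS]big_mkcond /= addnC.
    by congr (_ + _)%N; rewrite unfold_in; case: (b ord0).
  case: (b ord0); last first.
    rewrite addn0; under eq_fun do rewrite addr0.
    exact: has_moments_fst (momX b').
  by rewrite addn1; exact: has_moments_add (momX b') ha.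
Qed.

(** Transport along the enumeration of [J]. General finite index types are needed for families
    indexed by coordinate and summand. *)
Lemma iid_family (R : realType) (mu : probability (measurableTypeR R) R)
    (a : nat -> R) (J : finType) : has_moments mu id a ->
  exists (d : measure_display) (T : measurableType d) (Pr : probability T R)
    (X : J -> {RV Pr >-> R}),
  [/\ mutually_independent X, forall i, has_law mu (X i) &
    forall b : pred J, has_moments Pr (fun t => \sum_(i | b i) X i t)
      (convolution_power a #|b|)].
Proof.
move=> /(iid_ordinal #|J|) [d [T [Pr [X [indX lawX momX]]]]].
exists d, T, Pr, (fun i => X (enum_rank i)); split => // [B mB|b].
- have := indX (B \o enum_val) (fun i => mB _).
  rewrite (_ : \bigcap_(i in _) _ =
    \bigcap_(i in [set: J]) (X (enum_rank i) @^-1` B i)); last first.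
    apply/seteqP; split => t /= Bt i _.
      by have := Bt (enum_rank i) I; rewrite /= enum_rankK.
    by have := Bt (enum_val i) I; rewrite /= enum_valK.
  move=> ->; rewrite (reindex enum_rank) /=; last first.
    exact: onW_bij (enum_rank_bij J).
  by apply: eq_bigr => i _; rewrite enum_rankK.
- pose b' := [pred k : 'I_#|J| | b (enum_val k)].
  have -> : (fun t => \sum_(i | b i) X (enum_rank i) t) =
      (fun t => \sum_(k | b' k) X k t).
    apply/funext => t; rewrite (reindex (@enum_val J J)) /=; last first.
      exact: onW_bij (enum_val_bij J).
    by apply: eq_bigr => k _; rewrite enum_valK.
  suff -> : #|b| = #|b'| by exact: momX.
  rewrite -!sum1_card (reindex (@enum_val J J)) //=; exact: onW_bij (enum_val_bij J).
Qed.

(** * Normal moments and a matching non-normal law *)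

(** The density [f] coincides almost everywhere with the Radon-Nikodym derivative of [mu], both
    having the same integral over every measurable set, so the change of variables for that
    derivative applies to [f]. *)
Lemma integral_density (R : realType) (mu : probability (measurableTypeR R) R)
    (f g : R -> R) :
  measurable_fun [set: R] f -> (forall x, 0 <= f x) ->
  (forall A, measurable A -> mu A = (\int[lebesgue_measure]_(x in A) (f x)%:E)%E) ->
  measurable_fun [set: R] g ->
  lebesgue_measure.-integrable [set: R] (fun x => (g x * f x)%:E) ->
  mu.-integrable [set: R] (EFin \o g) /\
  (\int[mu]_x (g x)%:E = \int[lebesgue_measure]_x (g x * f x)%:E)%E.
Proof.
move=> mf f0 muE mg intgf.
have mEf : measurable_fun [set: measurableTypeR R] (EFin \o f).
  exact/measurable_EFinP.
have mEg : measurable_fun [set: measurableTypeR R] (EFin \o g).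
  exact/measurable_EFinP.
have dom : mu `<< lebesgue_measure.
  apply/null_content_dominatesP => A mA A0; rewrite muE //.
  by apply: null_set_integral => //; exact: measurable_funTS.
pose h := Radon_Nikodym_SigmaFinite.f mu lebesgue_measure.
have mh : measurable_fun [set: measurableTypeR R] h.
  apply: measurable_int; exact: Radon_Nikodym_SigmaFinite.f_integrable.
have hf : ae_eq lebesgue_measure [set: measurableTypeR R] h (EFin \o f).
  apply: integral_ae_eq => //.
    exact: Radon_Nikodym_SigmaFinite.f_integrable.
  by move=> A _ mA; rewrite -[RHS]muE // [RHS](Radon_Nikodym_SigmaFinite.f_integral dom).
(* Nonnegative integrands come first: applied to the absolute value of [g], they yield the
   integrability of [g] that the signed formula requires. *)
have ge0 (k : measurableTypeR R -> \bar R) :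
    measurable_fun [set: measurableTypeR R] k -> (forall x, (0 <= k x)%E) ->
    (\int[mu]_x k x = \int[lebesgue_measure]_x (k x * (f x)%:E))%E.
  move=> mk k0; rewrite -(Radon_Nikodym_SigmaFinite.change_of_variables dom) //.
  apply: ae_eq_integral => //.
  - exact: emeasurable_funM.
  - exact: emeasurable_funM.
  - exact: ae_eqe_mul2l.
have intg : mu.-integrable [set: measurableTypeR R] (EFin \o g).
  apply/integrableP; split => //.
  move/integrableP: intgf => [_]; rewrite ge0 //; last exact: measurableT_comp.
  apply: le_lt_trans; rewrite le_eqVlt; apply/orP; left; apply/eqP.
  by apply: eq_integral => x _; rewrite EFinM abseM (@gee0_abs _ (f x)%:E) ?lee_fin.
split => //; rewrite -(Radon_Nikodym_change_of_variables dom) //.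
apply: ae_eq_integral => //.
- by apply: emeasurable_funM.
- by apply: measurable_int intgf.
under [X in ae_eq _ _ _ X]eq_fun do rewrite EFinM.
apply: ae_eqe_mul2l; apply: ae_eq_trans hf.
exact/ae_eq_sym/ae_eq_Radon_Nikodym_SigmaFinite.
Qed.

(** On a symmetric interval the integral of [f] is a difference of values of [F], which tends to 0;
    dominated convergence, with [|f|] as the bound, passes to the whole line. *)
Lemma integral_derivative_eq0 (R : realType) (F f : R -> R) :
  continuous f -> (forall x : R, is_derive x 1 F (f x)) ->
  lebesgue_measure.-integrable [set: R] (EFin \o f) ->
  F n%:R @[n --> \oo] --> 0 -> F (- n%:R) @[n --> \oo] --> 0 ->
  (\int[lebesgue_measure]_x (f x)%:E = 0)%E.
Proof.
move=> cf dF intf Fy FNy.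
have dF1 x : derivable F x 1 by have [] := dF x.
have cF : continuous F by move=> x; apply/differentiable_continuous/derivable1_diffP.
(* [n.+1] keeps the interval nondegenerate at [n = 0], as the fundamental theorem of calculus
   requires. *)
pose D n : set R := `[- (n.+1%:R), n.+1%:R]%classic.
have E n : (\int[lebesgue_measure]_(x in D n) (f x)%:E =
    (F n.+1%:R - F (- n.+1%:R))%:E)%E.
  rewrite EFinB; apply: continuous_FTC2.
  - by rewrite (@lt_trans _ _ 0) ?oppr_lt0 ?ltr0n.
  - exact: continuous_subspaceT.
  - split; first by move=> x _; exact: dF1.
      exact/cvg_at_right_filter/cF.
    exact/cvg_at_left_filter/cF.
  - by move=> x _; rewrite derive1E; have [] := dF x.
have mEf := measurable_int _ intf.
have C1 : (\int[lebesgue_measure]_(x in D n) (f x)%:E)%E @[n --> \oo] -->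
    (\int[lebesgue_measure]_x (f x)%:E)%E.
  under eq_fun do rewrite integral_mkcond.
  have [|||||_ _] := @dominated_convergence _ _ R lebesgue_measure
    [set: measurableTypeR R] measurableT (fun n => (EFin \o f) \_ (D n))
    (EFin \o f) (fun x => `|(f x)%:E|%E).
  - move=> n; have mD : measurable (D n : set (measurableTypeR R)) by exact: measurable_itv.
    have mfD : measurable_fun (D n : set (measurableTypeR R)) (EFin \o f).
      by apply: measurable_funTS; exact: mEf.
    exact: ((measurable_restrictT (T1 := measurableTypeR R) (EFin \o f) mD).1 mfD).
  - exact: mEf.
  - apply: aeW => x _; apply: cvg_near_cst; near=> n.
    rewrite patchE mem_set // /D /= in_itv /= -ler_norml.
    rewrite (le_trans _ (_ : n%:R <= _)) ?ler_nat //.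
    by near: n; exact: nbhs_infty_ger.
  - exact: integrable_abse.
  - by apply: aeW => x n _; rewrite patchE; case: ifP => //; rewrite abse0.
  - exact.
have C2 : (\int[lebesgue_measure]_(x in D n) (f x)%:E)%E @[n --> \oo] --> (0 : \bar R)%E.
  under eq_fun do rewrite E.
  apply/fine_cvgP; split; first exact: nearW.
  have -> : (0 : R) = 0 - 0 by rewrite subr0.
  by apply: cvgB; [rewrite (cvg_shiftS (fun n => F n%:R))|
    rewrite (cvg_shiftS (fun n => F (- n%:R)))].
by have := cvg_unique _ C1 C2; exact.
Unshelve. all: by end_near. Qed.

Lemma cvg0_mul_nat_bounded (R : realType) (u : nat -> R) K :
  (forall n, `|u n| * n%:R <= K) -> u n @[n --> \oo] --> 0.
Proof.
move=> uK; apply/cvgr0Pnorm_lt => e e0; near=> n.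
have Kn : K / e < n%:R by near: n; exact: nbhs_infty_gtr.
have n0 : 0 < n%:R :> R.
  (* The hypothesis at [n = 0] gives [0 <= K]. *)
  by rewrite (le_lt_trans _ Kn) // divr_ge0 ?(ltW e0) // -(mulr0 `|u 0%N|) uK.
rewrite -(ltr_pM2r n0) (le_lt_trans (uK n)) // mulrC.
by rewrite -ltr_pdivrMr.
Unshelve. all: by end_near. Qed.

Lemma standard_normal_pdfE (R : realType) (x : R) :
  normal_pdf 0 1 x = normal_peak 1 * expR (- 2^-1 * x ^+ 2).
Proof.
rewrite normal_pdfE ?oner_neq0 //; congr (_ * expR _).
rewrite subr0 expr1n; lra.
Qed.

Lemma exprn_le_fact_expR (R : realType) (x : R) k : 0 <= x -> x ^+ k <= k`!%:R * expR x.
Proof.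
move=> x0; case: k => [|k].
  by rewrite expr0 fact0 mul1r (le_trans _ (expR_ge1Dx _)) // lerDl.
have := expR_ge1Dxn k x0; rewrite -(ler_pM2l (_ : 0 < k.+1`!%:R)); last first.
  by rewrite ltr0n fact_gt0.
by apply: le_trans; rewrite mulrDr mulrCA divff ?mulr1 ?lerDr // pnatr_eq0 -lt0n fact_gt0.
Qed.

(** The power is at most k! e^|x|, and e^|x| costs only half of the Gaussian exponent: up to a
    constant, the density of variance 2 remains. This one domination gives both integrability and
    decay at infinity. *)
Lemma power_normal_pdf_le (R : realType) k : exists K : R, 0 <= K /\
  forall x : R, `|x ^+ k * normal_pdf 0 1 x| <= K * normal_pdf 0 (Num.sqrt 2) x.
Proof.
pose s : R := Num.sqrt 2.
have s0 : s != 0 by rewrite gt_eqF // sqrtr_gt0.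
have p0 : 0 < normal_peak s := normal_peak_gt0 s0.
exists (k`!%:R * expR 1 * normal_peak 1 / normal_peak s); split.
  by rewrite !mulr_ge0 ?invr_ge0 ?expR_ge0 ?normal_peak_ge0.
move=> x; rewrite normrM (ger0_norm (normal_pdf_ge0 _ _ _)) normrX.
rewrite (normal_pdfE _ s0) mulrA divfK ?gt_eqF // /normal_fun subr0.
rewrite sqr_sqrtr // standard_normal_pdfE.
rewrite [leRHS]mulrAC mulrCA [leRHS]mulrC ler_wpM2l ?normal_peak_ge0 //.
(* This is |x| <= 1 + x^2/4, that is, the square of |x|/2 - 1 is nonnegative. *)
have h : expR `|x| <= expR 1 * expR (4^-1 * x ^+ 2).
  rewrite -expRD ler_expR -(real_normK (num_real x)).
  by have := sqr_ge0 (`|x| / 2 - 1); lra.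
apply: (le_trans (ler_wpM2r (expR_ge0 _) (exprn_le_fact_expR k (normr_ge0 x)))).
rewrite -!mulrA ler_wpM2l // (le_trans (ler_wpM2r (expR_ge0 _) h)) //.
rewrite -mulrA ler_wpM2l ?expR_ge0 // -expRD ler_expR; lra.
Qed.

Lemma integrable_power_normal_pdf (R : realType) k :
  lebesgue_measure.-integrable [set: R] (fun x => (x ^+ k * normal_pdf 0 1 x)%:E).
Proof.
have [K [K0 HK]] := power_normal_pdf_le R k.
apply: (le_integrable (mu := lebesgue_measure) (D := [set: measurableTypeR R])
  measurableT _ _ (integrableZl measurableT K (integrable_normal_pdf 0 (Num.sqrt 2)))).
- apply/measurable_EFinP; apply: measurable_funM; first exact: measurable_funX.
  exact: measurable_normal_pdf.
- move=> x _; rewrite /= lee_fin.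
  by rewrite [leRHS]ger0_norm ?HK // mulr_ge0 // normal_pdf_ge0.
Qed.

Lemma is_derive_power_normal_pdf (R : realType) k (x : R) :
  is_derive x 1 (fun y : R => y ^+ k * normal_pdf 0 1 y)
    (k%:R * (x ^+ k.-1 * normal_pdf 0 1 x) - x ^+ k.+1 * normal_pdf 0 1 x).
Proof.
have -> : (fun y : R => y ^+ k * normal_pdf 0 1 y) =
    (fun y : R => y ^+ k * (normal_peak 1 *: expR (- 2^-1 *: y ^+ 2))).
  by apply/funext => y; rewrite standard_normal_pdfE.
have d1 : is_derive x 1 (fun y : R => - 2^-1 *: y ^+ 2)
    (- 2^-1 *: ((2%:R * x ^+ 1) *: 1)).
  apply: (is_deriveZ (f := fun y : R => y ^+ 2)).
  exact: (is_deriveX 2 (is_derive_id x 1)).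
have d2 := is_deriveZ (normal_peak 1) (is_derive1_comp (is_derive_expR _) d1).
have d3 : is_derive x 1 (fun y : R => y ^+ k) ((k%:R * x ^+ k.-1) *: 1).
  by have := is_deriveX k (is_derive_id x 1); rewrite exprfctE.
apply: is_derive_eq (is_deriveM d3 d2) _.
rewrite /= standard_normal_pdfE [x ^+ k.+1]exprS /GRing.scale /=.
by move: (expR _) => e; move: (x ^+ k) (x ^+ k.-1) => y z; field.
Qed.

(** Integration by parts: with phi the normal density, the derivative of x^k phi is k x^(k-1) phi -
    x^(k+1) phi, and its integral over the line is 0. *)
Lemma normal_moments (R : realType) : exists m : nat -> R,
  [/\ forall k, (\int[lebesgue_measure]_x (x ^+ k * normal_pdf 0 1 x)%:E = (m k)%:E)%E,
    m 0%N = 1 & gaussian_recursion 1 m].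
Proof.
pose I k := (\int[lebesgue_measure]_x (x ^+ k * normal_pdf (0 : R) 1 x)%:E)%E.
have Ifin k : I k \is a fin_num.
  exact: integrable_fin_num (integrable_power_normal_pdf R k).
exists (fun k => fine (I k)); split => [k||k].
- by rewrite fineK.
- rewrite /I; under eq_integral do rewrite expr0 mul1r.
  by rewrite integral_normal_pdf.
pose F := fun x : R => x ^+ k * normal_pdf 0 1 x.
pose f := fun x : R =>
  k%:R * (x ^+ k.-1 * normal_pdf 0 1 x) - x ^+ k.+1 * normal_pdf 0 1 x.
have i1 : lebesgue_measure.-integrable [set: R]
    (fun x => k%:R%:E * (x ^+ k.-1 * normal_pdf 0 1 x)%:E)%E.
  by apply: integrableZl => //; exact: integrable_power_normal_pdf.
have i2 := integrable_power_normal_pdf R k.+1.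
have [K [K0 HK]] := power_normal_pdf_le R k.+1.
have s0 : Num.sqrt 2 != 0 :> R by rewrite gt_eqF // sqrtr_gt0.
(* [F x * x] is [x ^+ k.+1] times the density, hence bounded, so [F] is O(1/|x|) and vanishes at
   both infinities. *)
have FK (x : R) : `|F x| * `|x| <= K * normal_peak (Num.sqrt 2).
  apply: le_trans (_ : K * normal_pdf 0 (Num.sqrt 2) x <= _); last first.
    by rewrite ler_wpM2l // normal_pdf_ub.
  by apply: le_trans (HK x); rewrite -normrM /F exprS mulrC mulrA.
have : (\int[lebesgue_measure]_x (f x)%:E = 0)%E.
  apply: (@integral_derivative_eq0 _ F).
  - have cp j : continuous (fun x : R => x ^+ j * normal_pdf 0 1 x).
      move=> x; apply: cvgM; first exact: exprn_continuous.
      exact: continuous_normal_pdf (oner_neq0 _) _.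
    by move=> x; apply: cvgB; [apply: cvgMr; exact: cp|exact: cp].
  - by move=> x; exact: is_derive_power_normal_pdf.
  - under [X in _.-integrable _ X]eq_fun do rewrite /f /= EFinB EFinM.
    exact: integrableB.
  - apply: cvg0_mul_nat_bounded => n.
    by rewrite -[n%:R in X in _ * X]ger0_norm ?ler0n.
  - apply: (@cvg0_mul_nat_bounded _ _ (K * normal_peak (Num.sqrt 2))) => n.
    by have := FK (- n%:R); rewrite normrN normr_nat.
under eq_integral do rewrite /f EFinB EFinM.
rewrite integralB // integralZl //; last exact: integrable_power_normal_pdf.
rewrite -/(I _) -/(I _) => /eqP.
rewrite sube_eq ?add0e; last 2 first.
- by rewrite fin_numM.
- by rewrite fin_num_adde_defl.
by move=> /eqP <-; rewrite fineM // mul1r.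
Qed.

Lemma normal_prob_has_moments (R : realType) (m : nat -> R) :
  (forall k, (\int[lebesgue_measure]_x (x ^+ k * normal_pdf 0 1 x)%:E = (m k)%:E)%E) ->
  has_moments (normal_prob 0 1) (id : measurableTypeR R -> R) m.
Proof.
move=> hm k; rewrite -hm.
apply: (@integral_density _ (normal_prob 0 1) (normal_pdf 0 1)) => //.
- exact: measurable_normal_pdf.
- exact: normal_pdf_ge0.
- exact: integrable_power_normal_pdf.
Qed.

Lemma density_probability (R : realType) (f : R -> R) :
  measurable_fun [set: R] f -> (forall x, 0 <= f x) ->
  (\int[lebesgue_measure]_x (f x)%:E = 1)%E ->
  exists mu : probability (measurableTypeR R) R,
    forall A, measurable A -> mu A = (\int[lebesgue_measure]_(x in A) (f x)%:E)%E.
Proof.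
move=> mf f0 f1.
have mEf : measurable_fun [set: measurableTypeR R] (EFin \o f).
  exact/measurable_EFinP.
pose dens (A : set (measurableTypeR R)) : \bar R :=
  (\int[lebesgue_measure]_(x in A) (f x)%:E)%E.
have d0 : dens set0 = 0%E by rewrite /dens integral_set0.
have dge0 A : (0 <= dens A)%E by apply: integral_ge0 => x _; rewrite lee_fin.
have dsigma : semi_sigma_additive dens.
  move=> F mF tF mUF; rewrite /dens ge0_integral_bigcup //=; last 2 first.
  - by apply: measurable_funTS; exact: mEf.
  - by move=> x _; rewrite lee_fin.
  by apply: is_cvg_ereal_nneg_natsum_cond => n _ _; exact: dge0.
pose nu : {measure set (measurableTypeR R) -> \bar R} :=
  HB.pack dens (isMeasure.Build _ _ _ dens d0 dge0 dsigma).
pose P : probability (measurableTypeR R) R :=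
  HB.pack dens nu (Measure_isProbability.Build _ _ _ nu f1).
by exists P.
Qed.

Lemma integral_power_itv (R : realType) (k j : nat) :
  (\int[lebesgue_measure]_(x in `[0%R, j%:R]) ((x : R) ^+ k)%:E =
    (j%:R ^+ k.+1 / k.+1%:R)%:E)%E.
Proof.
case: j => [|j]; first by rewrite set_itv1 integral_set1 expr0n mul0r.
pose F (x : R) := k.+1%:R^-1 *: x ^+ k.+1.
have dF (x : R) : is_derive x 1 F (x ^+ k).
  have d : is_derive x 1 (fun y : R => y ^+ k.+1) ((k.+1%:R * x ^+ k) *: 1).
    by have := is_deriveX k.+1 (is_derive_id x 1); rewrite exprfctE.
  apply: is_derive_eq (is_deriveZ k.+1%:R^-1 d) _.
  by rewrite /GRing.scale /= mulr1 mulKf // pnatr_eq0.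
have cF : continuous F.
  by move=> x; apply/differentiable_continuous/derivable1_diffP; have [] := dF x.
rewrite (continuous_FTC2 (F := F)) ?ltr0n //.
- by rewrite -EFinB /F /GRing.scale /= expr0n mulr0 subr0 mulrC.
- by apply: continuous_subspaceT; exact: exprn_continuous.
- split; first by move=> x _; have [] := dF x.
    exact/cvg_at_right_filter/cF.
  exact/cvg_at_left_filter/cF.
- by move=> x _; rewrite derive1E; have [] := dF x.
Qed.

Lemma integral_power_indic (R : realType) (k j : nat) :
  lebesgue_measure.-integrable [set: R]
    (fun x : R => (x ^+ k * \1_(`[0%R, j%:R]%classic : set R) x)%:E) /\
  (\int[lebesgue_measure]_x ((x : R) ^+ k * \1_(`[0%R, j%:R]%classic : set R) x)%:E =
    (j%:R ^+ k.+1 / k.+1%:R)%:E)%E.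
Proof.
pose D : set R := `[0, j%:R]%classic.
have E : (fun x : R => (x ^+ k * \1_D x)%:E) = (fun x => (x ^+ k)%:E) \_ D.
  apply/funext => x; rewrite patchE indicE.
  by case: ifP => _; rewrite ?mulr1 ?mulr0.
rewrite E -integral_mkcond integral_power_itv; split => //.
have mD : measurable (D : set (measurableTypeR R)) by exact: measurable_itv.
apply/(integrable_mkcond (T := measurableTypeR R) _ mD).1.
apply: (@continuous_compact_integrable _ (fun x : R => x ^+ k)).
  exact: segment_compact.
by apply: continuous_subspaceT; exact: exprn_continuous.
Qed.

Lemma nonnormal_matching_law (R : realType) (m : nat -> R) (q : nat) :
  (forall k, (\int[lebesgue_measure]_x (x ^+ k * normal_pdf 0 1 x)%:E = (m k)%:E)%E) ->
  m 0%N = 1 ->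
  exists (mu : probability (measurableTypeR R) R) (a : nat -> R),
    [/\ has_moments mu id a, forall k, (k <= q)%N -> a k = m k & a q.+1 != m q.+1].
Proof.
move=> hm m0; pose phi : R -> R := normal_pdf 0 1.
(* Integrating x^k over [0, j] raises the exponent of j to [k.+1], so the finite difference must
   annihilate exponents up to [q.+1] but not [q.+2]. *)
pose M := q.+2.
pose c (j : nat) : R := (-1) ^+ j * ('C(M, j))%:R.
pose B := 1 + \sum_(j < M.+1) `|c j|.
have B0 : 0 < B by rewrite ltr_pwDl // sumr_ge0.
have phi0 x : 0 < phi x.
  by rewrite /phi standard_normal_pdfE mulr_gt0 ?expR_gt0 ?normal_peak_gt0 ?oner_neq0.
(* On [0, M], outside which [u] vanishes, the normal density is at least [phi M%:R], and [|u| <= B];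
   this size of [e] keeps [f] nonnegative. *)
pose e := phi M%:R / B.
have e0 : 0 < e by rewrite divr_gt0.
pose u (x : R) := \sum_(j < M.+1) c j * \1_(`[0%R, j%:R]%classic : set R) x.
pose f x := phi x + e * u x.
have m_u : measurable_fun [set: R] u.
  apply: measurable_sum => j; apply: measurable_funM => //.
have mphi : measurable_fun [set: R] phi by exact: measurable_normal_pdf.
have mf : measurable_fun [set: R] f.
  by apply: measurable_funD => //; exact: measurable_funM.
have uB x : `|u x| <= B.
  rewrite /B (le_trans (ler_norm_sum _ _ _)) // ler_wpDl // ler_sum // => j _.
  by rewrite normrM ler_piMr // indicE; case: (_ \in _); rewrite ?normr1 ?normr0.
have f0 x : 0 <= f x.
  have [xM|xM] := boolP ((0 <= x) && (x <= M%:R)).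
    have /andP[x0 xM'] := xM.
    have : phi M%:R <= phi x.
      rewrite /phi !standard_normal_pdfE ler_wpM2l ?normal_peak_ge0 // ler_expR.
      by rewrite ler_nM2l ?oppr_lt0 ?invr_gt0 // lerXn2r ?nnegrE.
    have : - (e * u x) <= phi M%:R.
      rewrite (le_trans (ler_norm _)) // normrN normrM (gtr0_norm e0).
      by rewrite /e mulrAC ler_pdivrMr // ler_wpM2l // ltW.
    by rewrite /f; lra.
  rewrite /f /u big1 ?mulr0 ?addr0 ?(ltW (phi0 x)) // => j _.
  rewrite indicE memNset ?mulr0 // /= in_itv /=; apply: contraNnot xM.
  by move=> /andP[-> xj]; rewrite (le_trans xj) // ler_nat -ltnS ltn_ord.
pose a k := m k + e / k.+1%:R * \sum_(j < M.+1) c j * j%:R ^+ k.+1.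
have hf k : lebesgue_measure.-integrable [set: R] (fun x => (x ^+ k * f x)%:E) /\
    (\int[lebesgue_measure]_x (x ^+ k * f x)%:E = (a k)%:E)%E.
  have E : (fun x : R => (x ^+ k * f x)%:E) = (fun x => (x ^+ k * phi x)%:E +
      \sum_(j < M.+1) (e * c j)%:E * (x ^+ k * \1_(`[0%R, j%:R]%classic : set R) x)%:E)%E.
    apply/funext => x; under eq_bigr do rewrite -EFinM.
    rewrite sumEFin -EFinD /f mulrDr; congr (_ + _)%:E.
    rewrite mulrCA /u !mulr_sumr; apply: eq_bigr => j _; ring.
  have i1 : lebesgue_measure.-integrable [set: R] (fun x => (x ^+ k * phi x)%:E).
    exact: integrable_power_normal_pdf.
  have i2 (j : 'I_M.+1) : lebesgue_measure.-integrable [set: R]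
      (fun x => ((e * c j)%:E * (x ^+ k * \1_(`[0%R, j%:R]%classic : set R) x)%:E)%E).
    by apply: integrableZl => //; exact: (integral_power_indic R k j).1.
  have i3 : lebesgue_measure.-integrable [set: R] (fun x =>
      (\sum_(j < M.+1) (e * c j)%:E * (x ^+ k * \1_(`[0%R, j%:R]%classic : set R) x)%:E)%E).
    exact: integrable_sum.
  rewrite E; split; first exact: integrableD.
  rewrite integralD // integral_sum // hm /a EFinD; congr (_ + _)%E.
  rewrite mulr_sumr -sumEFin; apply: eq_bigr => j _.
  rewrite integralZl //; last exact: (integral_power_indic R k j).1.
  rewrite (integral_power_indic R k j).2 -EFinM; congr (_%:E); ring.
have sumE k : (k < M)%N -> \sum_(j < M.+1) c j * j%:R ^+ k.+1 =
    (k.+1 == M)%:R * (-1) ^+ M * M`!%:R by move=> ?; exact: alternating_binomial_sum.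
have am k : (k <= q)%N -> a k = m k.
  move=> kq; have kM : (k < M)%N by rewrite /M ltnS (leq_trans kq).
  rewrite /a sumE // (_ : (k.+1 == M) = false).
    by rewrite !mul0r mulr0 addr0.
  by apply/negbTE; rewrite neq_ltn /M !ltnS kq.
have [mu muE] : exists mu : probability (measurableTypeR R) R,
    forall A, measurable A -> mu A = (\int[lebesgue_measure]_(x in A) (f x)%:E)%E.
  (* The total mass is the moment of order 0, which the perturbation does not change. *)
  apply: density_probability => //; rewrite -m0 -am // -(hf 0%N).2.
  by apply: eq_integral => x _; rewrite expr0 mul1r.
exists mu, a; split => // [k|].
  have [] := @integral_density _ mu f (fun x => x ^+ k) mf f0 muE _ (hf k).1.
    exact: measurable_funX.
  by move=> i E; split => //; rewrite E (hf k).2.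
(* At order [q.+1] the difference is [e / q.+2%:R] times (-1)^M M!, which is nonzero. *)
rewrite -subr_eq0 /a addrAC subrr add0r sumE //= eqxx mul1r.
rewrite mulf_eq0 negb_or mulf_eq0 invr_eq0 pnatr_eq0 gt_eqF //=.
by rewrite mulf_eq0 signr_eq0 pnatr_eq0 -lt0n fact_gt0.
Qed.

(** * The test functions *)

(** Stated along a direction of a normed space, to cover both the identity of the line and the
    coordinates of a vector. *)
Lemma is_derive_scaled_power (R : realType) (V : normedModType R) (l : V -> R)
    (x v : V) (dl c : R) n :
  is_derive x v l dl ->
  is_derive x v (fun y => c * l y ^+ n) (c * (n%:R * l x ^+ n.-1) * dl).
Proof.
move=> hl; have hX : is_derive x v (fun y => l y ^+ n) ((n%:R * l x ^+ n.-1) *: dl).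
  by have := is_deriveX n hl; rewrite exprfctE.
by apply: is_derive_eq (is_deriveZ c hX) _; rewrite /GRing.scale /= mulrA.
Qed.

(** The falling factorial vanishes for [k > N], so the truncated subtraction in the exponent is
    harmless. *)
Lemma derive1n_power (R : realType) N k :
  derive1n k (fun x : R => x ^+ N) = (fun x => (N ^_ k)%:R * x ^+ (N - k)).
Proof.
elim: k => [|k IH]; first by apply/funext => x; rewrite ffactn0 mul1r subn0.
apply/funext => x; rewrite derive1nS IH derive1E.
have [_ ->] := is_derive_scaled_power (N ^_ k)%:R (N - k) (is_derive_id x 1).
by rewrite mulr1 mulrA -natrM -ffactnSr subnS.
Qed.

Lemma derivable_derive1n_power (R : realType) N k (x : R) :
  derivable (derive1n k (fun x : R => x ^+ N)) x 1.
Proof.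
rewrite derive1n_power.
by have [] := is_derive_scaled_power (N ^_ k)%:R (N - k) (is_derive_id x 1).
Qed.

(** Viewed as a first power, the identity has derivatives 1, 0, 0, and so on. In the absolute
    continuity, [dlt = e] works: at order 0 the increments are the interval lengths, at higher
    orders the derivative is constant. *)
Lemma Cb_id (R : realType) m : Cb m (fun x : R => x).
Proof.
have E : (fun x : R => x) = (fun x => x ^+ 1) by apply/funext => x; rewrite expr1.
rewrite E; split => [k x _||].
- exact: derivable_derive1n_power.
- rewrite derive1n_power => e e0; exists e => // k a b ab _.
  case: m.-1 => [|j] sum_lt.
    rewrite ffactn0 subn0 (eq_bigr (fun i => b i - a i)) // => i _.
    by rewrite !mul1r !expr1 ger0_norm // subr_ge0.
  by rewrite big1 // => i _; rewrite subrr normr0.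
- exists 1 => k x _ _; rewrite derive1n_power; case: k => [|k].
    by rewrite expr0 mulr1 normr1.
  by rewrite ffact_small // mul0r normr0.
Qed.

(** With t = max(1, |x|), the derivative is at most b = N! t^N in absolute value. Since b >= 1, the
    exponent m/k can be raised to m, and t^(N m) <= 1 + |x|^(N m). *)
Lemma power_growth (R : realType) N m k (x : R) : (0 < k <= m)%N ->
  `|(N ^_ k)%:R * x ^+ (N - k)| `^ (m%:R / k%:R) <=
    N`!%:R ^+ m + N`!%:R ^+ m * `|x| `^ (N * m)%:R.
Proof.
move=> /andP[k0 km]; rewrite powR_mulrn ?normr_ge0 //.
have N1 : 1 <= N`!%:R :> R by rewrite ler1n fact_gt0.
pose t : R := Num.max 1 `|x|.
have t1 : 1 <= t by rewrite le_max lexx.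
have xt : `|x| <= t by rewrite le_max lexx orbT.
pose b := N`!%:R * t ^+ N.
have b1 : 1 <= b by rewrite mulr_ege1 // exprn_ege1.
have le_b : `|(N ^_ k)%:R * x ^+ (N - k)| <= b.
  rewrite normrM normr_nat normrX ler_pM //.
    rewrite ler_nat; have [kN|Nk] := leqP k N; last by rewrite ffact_small.
    by rewrite -(ffact_fact kN) leq_pmulr // fact_gt0.
  rewrite (@le_trans _ _ (t ^+ (N - k))) //; first by rewrite lerXn2r ?nnegrE // (le_trans _ xt).
  by rewrite ler_weXn2l // leq_subr.
have le1 : `|(N ^_ k)%:R * x ^+ (N - k)| `^ (m%:R / k%:R) <= b `^ (m%:R / k%:R).
  by rewrite ge0_ler_powR ?nnegrE ?divr_ge0 // (le_trans _ le_b).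
apply: (le_trans le1); have b0 : 0 <= b by exact: le_trans ler01 b1.
apply: (@le_trans _ _ (b `^ m%:R)).
  by rewrite ler_powR // ler_pdivrMr ?ltr0n // ler_peMr // ler1n.
rewrite powR_mulrn // exprMn -exprM -[X in _ <= X + _]mulr1 -mulrDr.
rewrite ler_wpM2l ?exprn_ge0 // /t; case: (leP 1 `|x|) => _.
  by rewrite lerDr.
by rewrite expr1n lerDl exprn_ge0.
Qed.

Lemma CP1_power (R : realType) N m :
  CP1 m (growth1 (N`!%:R ^+ m) (N`!%:R ^+ m) (N * m)%:R) (fun x : R => x ^+ N).
Proof.
split => [k x _|k x km]; first exact: derivable_derive1n_power.
by rewrite derive1n_power; exact: power_growth.
Qed.

Definition power_sum (R : realType) (d N : nat) (w : 'rV[R]_d) : R :=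
  \sum_(j < d) w 0 j ^+ N.

Lemma is_derive_coord (R : realType) d (w v : 'rV[R]_d) (i : 'I_d) :
  is_derive w v (fun w : 'rV[R]_d => w 0 i) (v 0 i).
Proof.
have C : (fun h : R => h^-1 *: (((fun w : 'rV[R]_d => w 0 i) \o shift w) (h *: v) -
    w 0 i)) @ 0^' --> v 0 i.
  apply: cvg_near_cst; near=> h.
  rewrite /= !mxE addrK /GRing.scale /= mulKf //.
  by near: h; exact: nbhs_dnbhs_neq.
split; first by apply/cvg_ex; exists (v 0 i).
exact: cvg_lim C.
Unshelve. all: by end_near. Qed.

Lemma is_derive_power_sum (R : realType) d N (w : 'rV[R]_d) (i : 'I_d) :
  is_derive w (delta_mx 0 i) (@power_sum R d N) (N%:R * w 0 i ^+ N.-1).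
Proof.
have -> : @power_sum R d N = \sum_(j < d) (fun w : 'rV[R]_d => 1 * w 0 j ^+ N).
  apply/funext => y; rewrite /power_sum fct_sumE.
  by apply: eq_bigr => j _; rewrite mul1r.
apply: is_derive_eq.
  apply: is_derive_sum => j.
  exact: is_derive_scaled_power (is_derive_coord _ _ _).
rewrite (bigD1 i) //= !mxE !eqxx mulr1 mul1r big1 ?addr0 // => j ji.
by rewrite mxE (negbTE ji) mulr0.
Qed.

(** Each summand depends on a single coordinate, so mixed derivatives vanish, as the factor
    [all (pred1 i) s] records. The list is nonempty because the undifferentiated sum still involves
    all coordinates. *)
Lemma partial_power_sum (R : realType) d N (s : seq 'I_d) (i : 'I_d) :
  partial (i :: s) (@power_sum R d N) =
  (fun w => (all (pred1 i) s)%:R * (N ^_ (size s).+1)%:R * w 0 i ^+ (N - (size s).+1)).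
Proof.
elim: s i => [|i' s IH] i.
  apply/funext => w /=; have [_ ->] := is_derive_power_sum N w i.
  by rewrite mul1r ffactn1 subn1.
apply/funext => w; rewrite [LHS]/= -/(partial (i' :: s) _) IH.
have [_ ->] := is_derive_scaled_power ((all (pred1 i') s)%:R * (N ^_ (size s).+1)%:R)
  (N - (size s).+1) (is_derive_coord w (delta_mx 0 i) i').
rewrite mxE eqxx /=; have [->|] := eqVneq i' i; last by rewrite mulr0 !mul0r.
by rewrite (ffactnSr N (size s).+1) natrM (subnS N (size s).+1) /= !mulrA mulr1.
Qed.

Lemma derivable_partial_power_sum (R : realType) d N (s : seq 'I_d) i w :
  derivable (partial s (@power_sum R d N)) w (delta_mx 0 i).
Proof.
case: s => [|i' s]; first by have [] := is_derive_power_sum N w i.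
rewrite partial_power_sum.
by have [] := is_derive_scaled_power ((all (pred1 i') s)%:R * (N ^_ (size s).+1)%:R)
  (N - (size s).+1) (is_derive_coord w (delta_mx 0 i) i').
Qed.

Lemma CP_power_sum (R : realType) d N m :
  CP m (growth (N`!%:R ^+ m) (N`!%:R ^+ m) (fun=> (N * m)%:R)) (@power_sum R d N).
Proof.
split => [s i w _|[//|i s] w sm]; first exact: derivable_partial_power_sum.
rewrite partial_power_sum.
apply: le_trans (_ : N`!%:R ^+ m + N`!%:R ^+ m * `|w 0 i| `^ (N * m)%:R <= _).
  apply: le_trans (power_growth N (w 0 i) sm).
  rewrite ge0_ler_powR ?nnegrE ?divr_ge0 //.
  by case: (all _ _); rewrite ?mul1r // !mul0r normr0.
rewrite lerD2l ler_wpM2l ?exprn_ge0 // (bigD1 i) //= lerDl.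
by apply: sumr_ge0 => j _; exact: powR_ge0.
Qed.

(** * Lower bounds on the error *)

Lemma has_moments_scale (R : realType) (d : measure_display) (T : measurableType d)
    (Pr : probability T R) (X : T -> R) (a : nat -> R) (c : R) :
  has_moments Pr X a ->
  has_moments Pr (fun t => c * X t) (fun k => c ^+ k * a k).
Proof.
move=> hX k; have [iX eX] := hX k.
have E : (fun t => ((c * X t) ^+ k)%:E) = (fun t => (c ^+ k)%:E * (X t ^+ k)%:E)%E.
  by apply/funext => t; rewrite exprMn EFinM.
rewrite E; split; first exact: integrableZl.
by rewrite integralZl // eX EFinM.
Qed.

Lemma has_moments_abs (R : realType) (d : measure_display) (T : measurableType d)
    (Pr : probability T R) (X : {RV Pr >-> R}) (a : nat -> R) k :
  has_moments Pr X a -> finite_abs_moment k%:R X.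
Proof.
move=> /(_ k) [/integrableP[_ iX] _]; rewrite /finite_abs_moment unlock.
by under eq_integral do rewrite powR_mulrn // -normrX.
Qed.

Lemma has_moments_matches (R : realType) (d : measure_display) (T : measurableType d)
    (Pr : probability T R) (X : {RV Pr >-> R}) (a m : nat -> R) p :
  has_moments (normal_prob 0 1) (id : measurableTypeR R -> R) m ->
  has_moments Pr X a -> (forall k, (k <= p)%N -> a k = m k) ->
  matches_normal_moments p X.
Proof.
move=> hm hX am k /andP[_ kp]; rewrite unlock.
by rewrite (hX k).2 am // -(hm k).2.
Qed.

Lemma standardized_moment (R : realType) (a m : nat -> R) (n q : nat) :
  (0 < n)%N -> m 0%N = 1 -> gaussian_recursion 1 m ->
  (forall k, (k <= q)%N -> a k = m k) ->
  (Num.sqrt n%:R)^-1 ^+ q.+1 * convolution_power a n q.+1 =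
    m q.+1 + n%:R `^ (1 - q.+1%:R / 2) * (a q.+1 - m q.+1).
Proof.
move=> n0 m0 hm am; have a0 : a 0%N = 1 by rewrite am.
have n0' : 0 < n%:R :> R by rewrite ltr0n.
have s0 : Num.sqrt n%:R != 0 :> R by rewrite gt_eqF // sqrtr_gt0.
have := convolution_power_diff n a0 am.
rewrite (gaussian_convolution_power n q.+1 m0 hm) => /eqP.
rewrite subr_eq => /eqP ->.
rewrite mulrDr addrC mulrA -exprMn mulVf // expr1n mul1r; congr (_ + _).
(* The remaining factor is n times n^(-(q+1)/2). *)
rewrite mulrA; congr (_ * _); rewrite powRD; last by
  apply/implyP => _; rewrite gt_eqF.
rewrite powRr1 ?(ltW n0') // mulrC; congr (_ * _).
rewrite mulrC powRN powRrM powR12_sqrt ?(ltW n0') // powR_mulrn ?sqrtr_ge0 //.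
by rewrite exprVn.
Qed.

Lemma has_moments_power_sum (R : realType) (d : measure_display)
    (T : measurableType d) (Pr : probability T R) D (V : 'I_D -> T -> R)
    (b : 'I_D -> nat -> R) N :
  (forall j, has_moments Pr (V j) (b j)) ->
  Pr.-integrable [set: T] (fun t => (power_sum N (random_vector V t))%:E) /\
  ('E_Pr[fun t => power_sum N (random_vector V t)] = (\sum_j b j N)%:E)%E.
Proof.
move=> hV.
have E : (fun t => (power_sum N (random_vector V t))%:E) =
    (fun t => \sum_(j < D) (V j t ^+ N)%:E)%E.
  apply/funext => t; rewrite sumEFin; congr (_%:E).
  by apply: eq_bigr => j _; rewrite mxE.
have iV (j : 'I_D) := (hV j N).1.
split; first by rewrite E; exact: integrable_sum.
by rewrite unlock E integral_sum // -sumEFin; apply: eq_bigr => j _; rewrite (hV j N).2.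
Qed.

(** The orders [m] and [e] are arbitrary: powers are smooth with polynomially bounded derivatives,
    and the matching law has moments of all orders. One lemma thus serves both parts of the
    theorem. *)
Lemma univariate_power_rate (R : realType) (p m e q : nat) (G : (R -> R) -> Prop)
    (rate : nat -> R) :
  (p <= q)%N -> G (fun x => x ^+ q.+1) ->
  (forall n, rate n = n%:R `^ (1 - q.+1%:R / 2)) ->
  univariate_rate_attained p m e G rate.
Proof.
move=> pq Gg rateE; have [M [hM M0 MS]] := normal_moments R.
have hN := normal_prob_has_moments hM.
have [mu [a [ha am aM]]] := nonnormal_matching_law q hM M0.
exists (q.+1`!%:R ^+ m), (q.+1`!%:R ^+ m), (q.+1 * m)%:R,
  (fun x => x ^+ q.+1), (fun x => x).
split; first by rewrite !exprn_ge0.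
split; first by split => //; [exact: CP1_power|exact: Cb_id].
split; first exact: (hN q.+1).1.
(* The error is exactly this constant times the rate. *)
exists mu, `|a q.+1 - M q.+1|; split; first by rewrite normr_gt0 subr_eq0.
move=> n n0; have [d [T [Pr [X [indX lawX momX]]]]] := iid_family 'I_n ha.
have mX i : has_moments Pr (X i) a := has_law_moments (lawX i) ha.
have := has_moments_scale (Num.sqrt n%:R)^-1 (momX predT).
rewrite -/(standardized_sum X) => mW; rewrite card_ord in mW.
exists d, T, Pr, X; split.
  split => // i.
    by apply: (has_moments_matches hN (mX i)) => k kp; rewrite am // (leq_trans kp).
  (* The growth exponent is a natural number, so the absolute moment required is of integer
     order. *)
  by rewrite -natrD; exact: has_moments_abs (mX i).
have [iW eW] := mW q.+1; split; first exact: iW.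
rewrite unlock [X in (`|X - _|)%E]eW (hN q.+1).2 -EFinB abse_EFin lee_fin.
rewrite (standardized_moment n0 M0 MS am) addrAC subrr add0r rateE.
by rewrite normrM mulrC (ger0_norm (powR_ge0 _ _)).
Qed.

(** The error is the sum over [j] of a power of [n_ j] times one common moment difference. As all
    terms have the same sign, it is at least the term of a coordinate [j0] with [n = n_ j0]. *)
Lemma multivariate_power_rate (R : realType) (d p m e q : nat)
    (G : ('rV[R]_d -> R) -> Prop) (rate : nat -> R) :
  (p <= q)%N -> G (@power_sum R d q.+1) ->
  (forall n, rate n = n%:R `^ (1 - q.+1%:R / 2)) ->
  multivariate_rate_attained p m e G rate.
Proof.
move=> pq Gg rateE; have [M [hM M0 MS]] := normal_moments R.
have hN := normal_prob_has_moments hM.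
have [mu [a [ha am aM]]] := nonnormal_matching_law q hM M0.
exists (q.+1`!%:R ^+ m), (q.+1`!%:R ^+ m), (fun=> (q.+1 * m)%:R),
  (@power_sum R d q.+1), (fun x => x).
split; first by rewrite !exprn_ge0.
split; first by split => //; [exact: CP_power_sum|exact: Cb_id].
(* The normal vector comes from the same construction, applied to the normal law. *)
have [dZ [TZ [PZ [Z [indZ lawZ _]]]]] := iid_family 'I_d hN.
have [iZ eZ] := has_moments_power_sum q.+1 (fun j => has_law_moments (lawZ j) hN).
exists dZ, TZ, PZ, Z; split => //; split; first exact: iZ.
exists mu, `|a q.+1 - M q.+1|; split; first by rewrite normr_gt0 subr_eq0.
move=> n_ n n0 [j0 nj0] _.
have [dT [T [Pr [Y [indY lawY momY]]]]] := iid_family {j : 'I_d & 'I_(n_ j)} ha.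
have mY s : has_moments Pr (Y s) a := has_law_moments (lawY s) ha.
pose X j (i : 'I_(n_ j)) := Y (Tagged (fun j => 'I_(n_ j)) i).
have mW j : has_moments Pr (standardized_sum (X j))
    (fun k => (Num.sqrt (n_ j)%:R)^-1 ^+ k * convolution_power a (n_ j) k).
  (* Stated for any commutative monoid, to be used both for the sum of the variables of a block and
     for its cardinality. *)
  have sumE (V : Type) (idx : V) (op : Monoid.com_law idx) F :
      \big[op/idx]_(s : {j : 'I_d & 'I_(n_ j)} | tag s == j) F s =
      \big[op/idx]_(i < n_ j) F (Tagged (fun j => 'I_(n_ j)) i).
    transitivity (\big[op/idx]_(k | k == j)
      \big[op/idx]_(i < n_ k) F (Tagged (fun j => 'I_(n_ j)) i)).
      by rewrite sig_big_dep /=; apply: eq_big => -[] // k i; rewrite andbT.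
    by rewrite big_pred1_eq.
  have := has_moments_scale (Num.sqrt (n_ j)%:R)^-1 (momY (fun s => tag s == j)).
  rewrite (_ : #|_| = n_ j); last by rewrite -sum1_card sumE sum1_card card_ord.
  by under eq_fun do rewrite sumE.
have [iW eW] := has_moments_power_sum q.+1 mW.
exists dT, T, Pr, X; split.
  split => [|j i|j i|j i l].
  - by rewrite (_ : (fun s => _) = Y) //; apply/funext => -[].
  - exact: lawY.
  - by apply: (has_moments_matches hN (mY _)) => k kp; rewrite am // (leq_trans kp).
  - by rewrite -natrD; exact: has_moments_abs (mY _).
split; first exact: iW.
rewrite eW eZ -EFinB abse_EFin lee_fin -sumrB.
rewrite (eq_bigr (fun j => (n_ j)%:R `^ (1 - q.+1%:R / 2) * (a q.+1 - M q.+1)));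
  last first.
  by move=> j _; rewrite (standardized_moment (n0 j) M0 MS am) addrAC subrr add0r.
rewrite -mulr_suml normrM mulrC ler_wpM2r // rateE nj0.
rewrite ger0_norm; last by apply: sumr_ge0 => j _; exact: powR_ge0.
by rewrite (bigD1 j0) //= lerDl; apply: sumr_ge0 => j _; exact: powR_ge0.
Qed.

Unset Implicit Arguments.

Theorem proposition3p1 (R : realType) :
  (forall p : nat, (2 <= p)%N ->
    (forall d : nat, (1 <= d)%N ->
      @multivariate_rate_attained R d p p p.+1 (fun _ => True)
        (fun n => n%:R `^ (- ((p%:R - 1) / 2)))) /\
    @univariate_rate_attained R p p.-1 p.+2 (fun _ => True)
      (fun n => n%:R `^ (- ((p%:R - 1) / 2)))) /\
  (forall p : nat, (2 <= p)%N -> ~~ odd p ->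
    (forall d : nat, (1 <= d)%N ->
      @multivariate_rate_attained R d p p.+2 p.+2 (@even_fun R 'rV[R]_d)
        (fun n => n%:R `^ (- (p%:R / 2)))) /\
    @univariate_rate_attained R p p p.+4 (@even_fun R R)
      (fun n => n%:R `^ (- (p%:R / 2)))).
Proof.
(* Both rates have the form n^(1 - N/2), with N = p + 1 here and N = p + 2 in [e2]. *)
have e1 (p : nat) : - ((p%:R - 1) / 2) = 1 - p.+1%:R / 2 :> R.
  by rewrite -natr1; field.
have e2 (p : nat) : - (p%:R / 2) = 1 - p.+2%:R / 2 :> R.
  by rewrite -addn2 natrD; field.
split; [move=> p _; split=> [d _|]|move=> p _ oddp; split=> [d _|]].
- by apply: (@multivariate_power_rate R d p p p.+1 p) => // n; rewrite e1.
- by apply: (@univariate_power_rate R p p.-1 p.+2 p) => // n; rewrite e1.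
- apply: (@multivariate_power_rate R d p p.+2 p.+2 p.+1) => // [w|n].
    by apply: eq_bigr => j _; rewrite mxE exprNn -signr_odd /= negbK (negbTE oddp) mul1r.
  by rewrite e2.
- apply: (@univariate_power_rate R p p p.+4 p.+1) => // [w|n].
    by rewrite exprNn -signr_odd /= negbK (negbTE oddp) mul1r.
  by rewrite e2.
Qed.
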